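(* Let $G=(V,E,s,t)$ be a directed multigraph with finite arc set $E$ and two distinguished vertices $s,t\in V$ (possibly equal). Let $\mathcal{PF}(G)$ be the path-free complex of $G$, regarded as a set of subsets of $E$. (a) If $G$ contains a useless arc or a cycle, or satisfies ($E=\varnothing$ and $s=t$), then the number $\#(\mathcal{PF}(G))$ of faces is even. (b) Otherwise, $\#(\mathcal{PF}(G))$ is odd.
   Context: Graphs are directed multigraphs; each arc has a source and a target in $V$; parallel arcs and self-loops are allowed. A walk from $v_0$ to $v_n$ is a sequence $(v_0,e_1,v_1,\ldots,e_n,v_n)$ with $n\ge 0$, $v_i\in V$, $e_i\in E$, where each $e_i$ is an arc from $v_{i-1}$ to $v_i$. A path is a walk that does not visit any vertex more than once; an $s-t$-path is a path from $s$ to $t$ (if $s=t$, this is the trivial path with no arcs). A cycle is a walk with $n\ge1$, $v_0=v_n$ and $v_0,\ldots,v_{n-1}$ distinct (so a self-loop gives a cycle). A useless arc is an arc that belongs to no $s-t$-path. A set $F\subseteq E$ contains a path if it contains every arc of it. The path-free complex is $\mathcal{PF}(G)=\{F\subseteq E : F \text{ contains no } s-t\text{-path}\}$; its elements (including possibly $\varnothing$) are its faces. *)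

(* Defs.v *)
From mathcomp Require Import all_boot.
From mathcomp Require Import boolp.

Set Implicit Arguments.
Unset Strict Implicit.
Unset Printing Implicit Defensive.

(* Only the arc set is finite; the vertex set may be infinite. *)
Record st_multigraph := STMultigraph {
  vertex_of : eqType;
  arc_of : finType;
  arc_src : arc_of -> vertex_of;
  arc_tgt : arc_of -> vertex_of;
  source : vertex_of;
  sink : vertex_of
}.

(* A walk (v_0, e_1, v_1, ..., e_n, v_n) is encoded by its start v_0 and its
   arcs [:: e_1; ...; e_n], since v_i = arc_tgt e_i for i > 0. *)
Fixpoint is_walk (G : st_multigraph) (x : vertex_of G) (w : seq (arc_of G))
    (y : vertex_of G) : bool :=
  if w is e :: w' then (arc_src e == x) && is_walk (arc_tgt e) w' y
  else x == y.

Definition is_path (G : st_multigraph) (x : vertex_of G) (w : seq (arc_of G))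
    (y : vertex_of G) : bool :=
  is_walk x w y && uniq (x :: [seq arc_tgt e | e <- w]).

(* The sequence under uniq is v_0, ..., v_(n-1): belast drops v_n. *)
Definition is_cycle (G : st_multigraph) (x : vertex_of G)
    (w : seq (arc_of G)) : bool :=
  [&& 0 < size w, is_walk x w x & uniq (belast x [seq arc_tgt e | e <- w])].

Definition is_st_path (G : st_multigraph) (w : seq (arc_of G)) : bool :=
  is_path (source G) w (sink G).

Definition useless (G : st_multigraph) (e : arc_of G) : Prop :=
  ~ exists w : seq (arc_of G), is_st_path w /\ e \in w.

Definition has_useless_arc (G : st_multigraph) : Prop :=
  exists e : arc_of G, useless e.

Definition has_cycle (G : st_multigraph) : Prop :=
  exists (x : vertex_of G) (w : seq (arc_of G)), is_cycle x w.

Definition contains_path (G : st_multigraph) (F : {set arc_of G})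
    (w : seq (arc_of G)) : Prop :=
  forall e : arc_of G, e \in w -> e \in F.

Definition path_free_complex (G : st_multigraph) : {set {set arc_of G}} :=
  [set F : {set arc_of G} |
    `[< ~ exists w : seq (arc_of G), is_st_path w /\ contains_path F w >]].

(* Main.v *)
Require Import Defs.
From mathcomp Require Import all_boot.
From mathcomp Require Import boolp.

(** Explore the graph from a set [S] of reached vertices with a set [D] of
    undecided arcs.  Deciding an arc of [D] from [S] to [v] removes it from [D]
    and, if the arc is present, adds [v] to [S].  Modulo 2, the number of
    [F \subset D] for which the sink is reachable from [S] is the sum of the
    counts of the two resulting states, and it vanishes as soon as the presence
    of some arc of [D] is irrelevant.  An arc of [D] entering [S] is irrelevant.
    Along a cycle, either some arc enters [S] or no arc is ever decided, so the
    count is even.  In an acyclic graph without useless arcs exactly one of the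
    two states is not killed by an irrelevant arc, so the count is odd. *)

Lemma card_subsets_split {T : finType} (P : pred {set T}) (D : {set T}) (e : T) :
  e \in D ->
  #|[set F : {set T} | (F \subset D) && P F]| =
  #|[set F : {set T} | (F \subset D :\ e) && P F]| +
  #|[set F : {set T} | (F \subset D :\ e) && P (e |: F)]|.
Proof.
move=> eD; rewrite -(cardsID [set F : {set T} | e \notin F]); congr (_ + _).
  by apply: eq_card => F; rewrite !inE subsetD1 andbAC.
rewrite -[RHS](card_in_imset (f := fun F : {set T} => e |: F)).
  apply: eq_card => F; rewrite !inE negbK; apply/idP/imsetP.
    case/and3P=> eF FD PF; exists (F :\ e); last by rewrite setD1K.
    by rewrite inE setD1K // PF setSD.
  case=> F'; rewrite inE subsetD1 => /andP[/andP[F'D eF'] PF'] ->.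
  by rewrite setU11 PF' subUset sub1set eD F'D.
move=> F1 F2; rewrite !inE !subsetD1.
move=> /andP[/andP[_ e1] _] /andP[/andP[_ e2] _] E.
by rewrite -(setU1K e1) -(setU1K e2) E.
Qed.

(** * Walks, paths and cycles *)

Lemma walk_suffix_path {G : st_multigraph} (x z y : vertex_of G) p :
  is_path z p y -> x \in z :: [seq arc_tgt e | e <- p] ->
  exists2 q, is_path x q y & {subset q <= p}.
Proof.
elim: p z => [|e p IH] z zpy.
  by rewrite /= inE => /eqP->; exists [::].
rewrite inE => /orP[/eqP->|xp]; first by exists (e :: p).
move: zpy => /= /andP[/= /andP[_ w] /andP[_ u]].
have [||q qP qp] := IH (arc_tgt e); first by rewrite /is_path w.
  exact: xp.
by exists q => // a /qp aq; rewrite inE aq orbT.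
Qed.

(** Loop erasure from the end: if [x] lies on the path already extracted from the tail, the suffix
    of that path from [x] serves; otherwise the first arc is prepended to it. *)
Lemma walk_path {G : st_multigraph} (x y : vertex_of G) w :
  is_walk x w y -> exists2 p, is_path x p y & {subset p <= w}.
Proof.
elim: w x => [|e w IH] x /=.
  by move=> xy; exists [::] => //; rewrite /is_path /= xy.
case/andP=> ex /IH[p pP pw].
have [xp|xp] := boolP (x \in arc_tgt e :: [seq arc_tgt a | a <- p]).
  have [q qP qp] := walk_suffix_path _ _ _ _ pP xp.
  by exists q => // a /qp /pw aw; rewrite inE aw orbT.
exists (e :: p); last first.
  by move=> a; rewrite !inE => /orP[->//|/pw->]; rewrite orbT.
by case/andP: pP => pw' pu; rewrite /is_path /= ex pw' xp.
Qed.

(** Only the tail [w] is shortened to a path [p]; keeping [e] in front makes the result nonempty,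
    which also covers self-loops. *)
Lemma closed_walk_has_cycle {G : st_multigraph} (x : vertex_of G) e w :
  is_walk x (e :: w) x -> has_cycle G.
Proof.
move=> /= /andP[ex /walk_path[p /andP[pw pu] _]].
exists x, (e :: p); rewrite /is_cycle /= ex pw /=.
have last_x : last (arc_tgt e) [seq arc_tgt a | a <- p] = x.
  elim: p (arc_tgt e) pw {pu} => [|a p IH] z /=; first by move/eqP.
  by case/andP=> _ /IH.
(* Moving the last vertex [x] of the path [p] to the front gives the vertices that a cycle must have
   distinct. *)
by move: pu; rewrite lastI last_x rcons_uniq.
Qed.

Lemma walk_cat {G : st_multigraph} (x y z : vertex_of G) w1 w2 :
  is_walk x w1 y -> is_walk y w2 z -> is_walk x (w1 ++ w2) z.
Proof.
elim: w1 x => [|e w1 IH] x /=; first by move/eqP->.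
by case/andP=> -> /IH.
Qed.

Lemma walk_arc_pred {G : st_multigraph} (x y : vertex_of G) w a :
  is_walk x w y -> a \in w ->
  arc_src a = x \/ exists2 b, b \in w & arc_tgt b = arc_src a.
Proof.
elim: w x => [|e w IH] x //= /andP[/eqP ex wP]; rewrite inE => /orP[/eqP->|aw].
  by left.
right; have [->|[b bw <-]] := IH _ wP aw; first by exists e => //; rewrite inE eqxx.
by exists b => //; rewrite inE bw orbT.
Qed.

Lemma walk_arc_succ {G : st_multigraph} (x y : vertex_of G) w a :
  is_walk x w y -> a \in w ->
  arc_tgt a = y \/ exists2 b, b \in w & arc_src b = arc_tgt a.
Proof.
elim: w x => [|e w IH] x //= /andP[_ wP]; rewrite inE => /orP[/eqP->|aw].
  case: w wP {IH} => [/eqP->|b w /= /andP[/eqP bE _]]; first by left.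
  by right; exists b => //; rewrite !inE eqxx orbT.
have [->|[b bw <-]] := IH _ wP aw; first by left.
by right; exists b => //; rewrite inE bw orbT.
Qed.

Lemma closed_walk_arc_pred {G : st_multigraph} (x : vertex_of G) w a :
  is_walk x w x -> a \in w -> exists2 b, b \in w & arc_tgt b = arc_src a.
Proof.
move=> wP aw; have [->|//] := walk_arc_pred _ _ _ _ wP aw.
case: w wP aw => // e w wP _.
(* An arc leaving the base point [x] is preceded by the last arc of the closed walk. *)
exists (last e w); first exact: mem_last.
elim: w e {1}x wP => [|e' w IH] e z /= /andP[_]; first by move/eqP.
exact: IH.
Qed.

(** The rank of [x] counts the arcs from whose target [x] can be reached, a finite number even if
    there are infinitely many vertices. Passing along [a] adds at least [a] itself, since otherwise
    [a] would lie on a closed walk. *)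
Lemma acyclic_rank (G : st_multigraph) :
  ~ has_cycle G ->
  exists r : vertex_of G -> nat, forall a : arc_of G, r (arc_src a) < r (arc_tgt a).
Proof.
move=> acyc.
pose anc (x : vertex_of G) := [set a : arc_of G | `[< exists w, is_walk (arc_tgt a) w x >]].
exists (fun x => #|anc x|) => a; apply: proper_card.
apply/properP; split.
  apply/subsetP => b; rewrite !inE => /asboolP[w wP]; apply/asboolP.
  by exists (w ++ [:: a]); apply: walk_cat wP _; rewrite /= !eqxx.
exists a; rewrite inE; first by apply/asboolP; exists [::] => /=.
apply/negP => /asboolP[w wP]; apply: acyc.
by apply: (closed_walk_has_cycle (arc_src a) a w); rewrite /= eqxx.
Qed.

(** * Reachability counts modulo 2 *)

Definition reaches {G : st_multigraph} (S : seq (vertex_of G))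
    (F : {set arc_of G}) : Prop :=
  exists x w, [/\ x \in S, is_walk x w (sink G) & {subset w <= F}].

Definition reach_count {G : st_multigraph} (S : seq (vertex_of G))
    (D : {set arc_of G}) : nat :=
  #|[set F : {set arc_of G} | (F \subset D) && `[< reaches S F >]]|.

Lemma reachesW {G : st_multigraph} (S S' : seq (vertex_of G)) (F F' : {set arc_of G}) :
  {subset S <= S'} -> F \subset F' -> reaches S F -> reaches S' F'.
Proof.
move=> SS' /subsetP FF' [x [w [xS wP wF]]]; exists x, w; split=> //.
  exact: SS'.
by move=> a /wF /FF'.
Qed.

(** What follows the last use of [e] on a walk starts at [arc_tgt e] and avoids [e]; a walk that
    never uses [e] already lies in [F]. *)
Lemma reaches_setU1 {G : st_multigraph} (S : seq (vertex_of G)) e (F : {set arc_of G}) :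
  reaches S (e |: F) -> reaches (arc_tgt e :: S) F.
Proof.
case=> x [w [xS wP wF]].
suff [//|{}wF] : reaches (arc_tgt e :: S) F \/ {subset w <= F}.
  by exists x, w; rewrite inE xS orbT.
elim: w x wP wF {xS} => [|a w IH] x /=; first by right.
case/andP=> _ wP awF.
have [|//|wF] := IH _ wP; [|by left|].
  by move=> b bw; apply: awF; rewrite inE bw orbT.
have := awF a; rewrite !inE eqxx => /(_ isT) /orP[/eqP ae|aF].
  by left; exists (arc_tgt e), w; rewrite inE eqxx -ae.
by right=> b; rewrite inE => /orP[/eqP->|/wF].
Qed.

Lemma reaches_setU1_src {G : st_multigraph} (S : seq (vertex_of G)) e (F : {set arc_of G}) :
  arc_src e \in S -> reaches (arc_tgt e :: S) F -> reaches S (e |: F).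
Proof.
move=> eS [x [w [xS wP wF]]].
have wF' : {subset w <= e |: F} by move=> a /wF aF; rewrite !inE aF orbT.
move: xS; rewrite inE => /orP[/eqP xe|xS]; last by exists x, w.
exists (arc_src e), (e :: w); split=> //=; first by rewrite eqxx -xe.
by move=> a; rewrite inE => /orP[/eqP->|/wF'//]; rewrite setU11.
Qed.

Lemma reach_count_split {G : st_multigraph} (S : seq (vertex_of G)) e (D : {set arc_of G}) :
  e \in D -> arc_src e \in S ->
  reach_count S D = reach_count S (D :\ e) + reach_count (arc_tgt e :: S) (D :\ e).
Proof.
move=> eD eS; rewrite /reach_count (card_subsets_split _ _ _ eD); congr (_ + _).
apply: eq_card => F; rewrite !inE; congr (_ && _).
by apply: asbool_equiv_eq; split; [apply: reaches_setU1 | apply: reaches_setU1_src].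
Qed.

(** Adding [e] pairs the counted sets without [e] with those containing it. *)
Lemma even_reach_count_irrelevant {G : st_multigraph} (S : seq (vertex_of G)) e
    (D : {set arc_of G}) :
  e \in D ->
  (forall F : {set arc_of G}, F \subset D :\ e -> reaches S (e |: F) -> reaches S F) ->
  ~~ odd (reach_count S D).
Proof.
move=> eD irr; rewrite /reach_count (card_subsets_split _ _ _ eD).
rewrite [X in _ + X](_ : _ = #|[set F : {set arc_of G} | (F \subset D :\ e) && `[< reaches S F >]]|).
  by rewrite addnn odd_double.
apply: eq_card => F; rewrite !inE; case FD: (F \subset D :\ e) => //=.
apply: asbool_equiv_eq; split; first exact: irr.
by apply: reachesW => //; apply: subsetUr.
Qed.

Lemma even_reach_count_tgt {G : st_multigraph} (S : seq (vertex_of G)) e (D : {set arc_of G}) :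
  e \in D -> arc_tgt e \in S -> ~~ odd (reach_count S D).
Proof.
move=> eD eS; apply: (even_reach_count_irrelevant _ _ _ eD) => F _ /reaches_setU1.
by apply: reachesW => // x; rewrite inE => /orP[/eqP->|].
Qed.

Lemma walk_closed {G : st_multigraph} (K : pred (vertex_of G)) (F : {set arc_of G}) x w y :
  (forall a, a \in F -> K (arc_src a) -> K (arc_tgt a)) ->
  K x -> is_walk x w y -> {subset w <= F} ->
  K y /\ (forall a, a \in w -> K (arc_src a)).
Proof.
move=> KF; elim: w x => [|a w IH] x Kx /=; first by move/eqP<-.
case/andP=> /eqP ax wP awF; rewrite -ax in Kx.
have [|//||Ky Kw] := IH (arc_tgt a).
- by apply: KF => //; apply: awF; rewrite inE eqxx.
- by move=> b bw; apply: awF; rewrite inE bw orbT.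
by split=> // b; rewrite inE => /orP[/eqP->|/Kw].
Qed.

(** A walk from [S] inside [D] never leaves [K], so it cannot use [e], and [e] is irrelevant. *)
Lemma even_reach_count_unreachable {G : st_multigraph} (K : pred (vertex_of G))
    (S : seq (vertex_of G)) e (D : {set arc_of G}) :
  (forall a, a \in D -> K (arc_src a) -> K (arc_tgt a)) ->
  {subset S <= K} -> e \in D -> ~~ K (arc_src e) -> ~~ odd (reach_count S D).
Proof.
move=> KD SK eD nKe; apply: (even_reach_count_irrelevant _ _ _ eD) => F FD.
case=> x [w [xS wP wF]].
have wD : {subset w <= D}.
  move=> a /wF; rewrite !inE => /orP[/eqP->//|/(subsetP FD)].
  by rewrite inE => /andP[].
have [_ Kw] := walk_closed _ _ _ _ _ KD (SK _ xS) wP wD.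
exists x, w; split=> // a aw; move: (wF a aw); rewrite !inE => /orP[/eqP ae|//].
by have := Kw a aw; rewrite ae => Ke; rewrite [K _]Ke in nKe.
Qed.

(* [C] stands for the arc set of a cycle; only predecessor-closedness matters. *)
Lemma even_reach_count_cyclic {G : st_multigraph} (C : {set arc_of G})
    (S : seq (vertex_of G)) (D : {set arc_of G}) :
  C != set0 -> (forall a, a \in C -> exists2 b, b \in C & arc_tgt b = arc_src a) ->
  C \subset D -> ~~ odd (reach_count S D).
Proof.
move=> C0 Cpred; elim: {D}_.+1 {-2}D (ltnSn #|D|) S => // n IH D; rewrite ltnS => Dn S CD.
have [[a aD aS]|tgtS] := pselect (exists2 a, a \in D & arc_tgt a \in S).
  exact: even_reach_count_tgt aD aS.
have [[e eD eS]|srcS] := pselect (exists2 a, a \in D & arc_src a \in S).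
  have De : #|D :\ e| < n by rewrite (leq_trans _ Dn) // [X in _ < X](cardsD1 e) eD.
  (* If [e] were in [C], its predecessor in [C] would enter [S], a case already settled. *)
  have CDe : C \subset D :\ e.
    rewrite subsetD1 CD; apply/negP => /Cpred[b bC be]; apply: tgtS.
    by exists b; rewrite ?be // (subsetP CD).
  by rewrite (reach_count_split _ _ _ eD eS) oddD !(negPf (IH _ De _ CDe)).
(* Now no arc of [D] leaves [S], so [S] itself is the closed set and any arc of [C] is
   unreachable. *)
have [e eC] := set0Pn _ C0; have eD := subsetP CD _ eC.
apply: (even_reach_count_unreachable (mem S) _ _ _ _ _ eD) => //.
  by move=> a aD aS; case: srcS; exists a.
by apply/negP => eS; apply: srcS; exists e.
Qed.

(** The hypotheses are a local form of usefulness, stable under deciding an arc: each undecided arc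
    continues backwards to [S] and forwards to the sink. If another undecided arc enters the target
    of the decided arc [e], the state with [e] present is even; otherwise the state with [e] absent
    is. The other state inherits the hypotheses. *)
Lemma odd_reach_count_acyclic {G : st_multigraph} (r : vertex_of G -> nat)
    (S : seq (vertex_of G)) (D : {set arc_of G}) :
  (forall a : arc_of G, r (arc_src a) < r (arc_tgt a)) ->
  (forall a, a \in D -> arc_tgt a \notin S) ->
  (forall a, a \in D -> arc_src a \in S \/ exists2 b, b \in D & arc_tgt b = arc_src a) ->
  (forall a, a \in D -> arc_tgt a = sink G \/ exists2 b, b \in D & arc_src b = arc_tgt a) ->
  sink G \in S \/ D != set0 ->
  odd (reach_count S D).
Proof.
move=> rP; elim: {D}_.+1 {-2}D (ltnSn #|D|) S => // n IH D; rewrite ltnS => Dn S.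
move=> tgtS predD succD.
have [-> [tS|//]|/set0Pn[e0 e0D] _] := eqVneq D set0.
  rewrite /reach_count (_ : finset _ = [set set0]) ?cards1 //.
  apply/setP => F; rewrite !inE subset0; case: eqVneq => //= _.
  by apply/asboolP; exists (sink G), [::]; split => //=.
have [e eD eS] : exists2 e, e \in D & arc_src e \in S.
  (* An arc with source of least rank has no predecessor in [D], so it starts in [S]. *)
  have [e eD emin] := @arg_minnP _ e0 (mem D) (fun a => r (arc_src a)) e0D.
  exists e => //; have [//|[b bD be]] := predD e eD.
  by have := emin b bD; rewrite leqNgt -be rP.
have De : #|D :\ e| < n by rewrite (leq_trans _ Dn) // [X in _ < X](cardsD1 e) eD.
(* The successor is never [e], whose source lies in [S] while no arc of [D] enters [S]. *)
have succ_e a : a \in D ->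
    arc_tgt a = sink G \/ exists2 b, b \in D :\ e & arc_src b = arc_tgt a.
  move=> aD; have [->|[b bD ba]] := succD a aD; first by left.
  right; exists b => //; rewrite !inE bD andbT; apply/eqP => be.
  by have := tgtS a aD; rewrite -ba be eS.
rewrite (reach_count_split _ _ _ eD eS) oddD.
have [[a aDe ae]|lone] := pselect (exists2 a, a \in D :\ e & arc_tgt a = arc_tgt e).
  rewrite (negPf (even_reach_count_tgt (arc_tgt e :: S) _ _ aDe _)); last by rewrite ae inE eqxx.
  rewrite addbF; apply: IH => //.
  - by move=> b /setD1P[_ /tgtS].
  - move=> b /setD1P[_ /predD[->|[c cD <-]]]; [by left | right].
    have [->|ce] := eqVneq c e; first by exists a.
    by exists c => //; rewrite !inE ce.
  - by move=> b /setD1P[_ /succ_e].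
  - by right; apply/set0Pn; exists a.
rewrite (_ : odd (reach_count S _) = false) /=.
  apply: IH => //.
  - move=> b bDe; have /setD1P[_ bD] := bDe.
    rewrite inE (negPf (tgtS b bD)) orbF; apply/eqP => be.
    by apply: lone; exists b.
  - move=> b /setD1P[_ /predD[bS|[c cD <-]]]; first by left; rewrite inE bS orbT.
    have [->|ce] := eqVneq c e; first by left; rewrite inE eqxx.
    by right; exists c => //; rewrite !inE ce.
  - by move=> b /setD1P[_ /succ_e].
  - have [->|[b bDe _]] := succ_e e eD; first by left; rewrite inE eqxx.
    by right; apply/set0Pn; exists b.
(* Without [e], nothing enters [arc_tgt e]. Either this vertex is the sink and the count is 0, or
   some undecided arc leaves it and is irrelevant. *)
pose K : pred (vertex_of G) := fun x => x != arc_tgt e.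
have KD a : a \in D :\ e -> K (arc_src a) -> K (arc_tgt a).
  by move=> aDe _; apply/eqP => ae; apply: lone; exists a.
have SK : {subset S <= K}.
  by move=> x xS; apply/eqP => xe; have := tgtS e eD; rewrite -xe xS.
have [et|[b bDe be]] := succ_e e eD; last first.
  by apply: negbTE; apply: (even_reach_count_unreachable K _ _ _ KD SK bDe); rewrite /K be eqxx.
rewrite /reach_count (_ : finset _ = set0) ?cards0 //.
apply/setP => F; rewrite !inE; apply/negP => /andP[FD /asboolP[x [w [xS wP wF]]]].
have wD : {subset w <= D :\ e} by move=> a /wF /(subsetP FD).
have [] := walk_closed _ _ _ _ _ KD (SK _ xS) wP wD.
by rewrite /K et eqxx.
Qed.

(** * From reachability counts to the path-free complex *)

Lemma reaches_source_pathP {G : st_multigraph} (F : {set arc_of G}) :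
  reaches [:: source G] F <-> exists w, is_st_path w /\ contains_path F w.
Proof.
split=> [[x [w []]]|[w [/andP[wP _] wF]]].
  rewrite inE => /eqP-> /walk_path[p pP pw] wF.
  by exists p; split=> // a /pw /wF.
by exists (source G), w; rewrite inE eqxx.
Qed.

(** The faces are the complement of the counted sets among all [2 ^ #|arc_of G|] sets of arcs, and
    this power is odd only when there are no arcs. *)
Lemma odd_card_path_free (G : st_multigraph) :
  odd #|path_free_complex G| =
  (#|arc_of G| == 0) (+) odd (reach_count [:: source G] [set: arc_of G]).
Proof.
have -> : path_free_complex G =
    ~: [set F : {set arc_of G} | (F \subset setT) && `[< reaches [:: source G] F >]].
  apply/setP => F; rewrite !inE subsetT /= -asbool_neg.
  by apply: asbool_equiv_eq; rewrite reaches_source_pathP.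
rewrite /reach_count; set A := finset _.
have := cardsC A; rewrite -cardsT -powersetT card_powerset cardsT => /(congr1 odd).
by rewrite oddD oddX orbF => <-; rewrite addbC addKb.
Qed.

Theorem corollary1p6 (G : st_multigraph) :
  ((has_useless_arc G \/ has_cycle G \/
      (#|arc_of G| = 0 /\ source G = sink G)) ->
    ~~ odd #|path_free_complex G|) /\
  (~ (has_useless_arc G \/ has_cycle G \/
      (#|arc_of G| = 0 /\ source G = sink G)) ->
    odd #|path_free_complex G|).
Proof.
have arcs_neq0 (e : arc_of G) : (#|arc_of G| == 0) = false.
  by apply/negbTE; rewrite -lt0n; apply/card_gt0P; exists e.
rewrite odd_card_path_free; split.
  case=> [[e e_useless]|[[x [w /and3P[w0 wP _]]]|[E0 st]]].
  - rewrite (arcs_neq0 e) addFb; apply: (@even_reach_count_irrelevant _ _ e) => // F _.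
    move=> /reaches_source_pathP[p [pP pF]]; apply/reaches_source_pathP.
    exists p; split=> // a ap; move: (pF a ap); rewrite !inE => /orP[/eqP ae|//].
    by case: e_useless; exists p; rewrite -ae.
  - have [e ew] : exists e, e \in w by case: w w0 {wP} => // e w _; exists e; rewrite inE eqxx.
    rewrite (arcs_neq0 e) addFb.
    apply: (even_reach_count_cyclic [set a in w]); last exact: subsetT.
      by apply/set0Pn; exists e; rewrite inE.
    move=> a; rewrite inE => /(closed_walk_arc_pred _ _ _ wP)[b bw ba].
    by exists b; rewrite ?inE.
  (* The trivial path is contained in the empty set, the only set of arcs, so the count is 1. *)
  - rewrite E0 eqxx /reach_count (_ : finset _ = powerset setT).
      by rewrite card_powerset cardsT E0.
    apply/setP => F; rewrite !inE subsetT /=; apply/asboolP.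
    by exists (source G), [::]; rewrite /= inE st eqxx.
move=> nH.
have [r rP] : exists r : vertex_of G -> nat, forall a : arc_of G, r (arc_src a) < r (arc_tgt a).
  by apply: acyclic_rank => cyc; apply: nH; right; left.
have useful (e : arc_of G) : exists w, is_st_path w /\ e \in w.
  by apply: contrapT => ne; apply: nH; left; exists e.
have [E0|/card_gt0P[e _]] := posnP #|arc_of G|.
  rewrite /reach_count (_ : finset _ = set0) ?cards0 //.
  apply/setP => F; rewrite !inE; apply/negP => /andP[_ /asboolP[x [w [xs wP _]]]].
  case: w wP => [/= /eqP xt|e w _].
    by apply: nH; right; right; split=> //; move: xs; rewrite inE xt => /eqP.
  by have := arcs_neq0 e; rewrite E0.
rewrite addFb; apply: (odd_reach_count_acyclic r _ _ rP).
(* A path through [a] visits the source only at its start, so [a] does not enter it; the same path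
   supplies predecessors and successors below. *)
- move=> a _; have [w [/andP[_ /andP[sw _]] aw]] := useful a.
  by rewrite inE; apply: contraNneq sw => <-; apply: map_f.
- move=> a _; have [w [/andP[wP _] aw]] := useful a.
  have [->|[b _ <-]] := walk_arc_pred _ _ _ _ wP aw; first by left; rewrite inE eqxx.
  by right; exists b.
- move=> a _; have [w [/andP[wP _] aw]] := useful a.
  have [->|[b _ <-]] := walk_arc_succ _ _ _ _ wP aw; first by left.
  by right; exists b.
- by right; apply/set0Pn; exists e.
Qed.
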